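(* Let $\hat\alpha$ be any automorphism of $\hat{\mathcal X}$ and put $\varphi:=\varphi_0\circ\hat\alpha$. Then the map $S\mapsto\varphi(S)$ induces: (a) a bijection from the set of centric hexagons of $\hat{\mathcal X}$ with center $n_0$ onto the set of non-linear $3$-cliques of $\Gamma$; (b) a bijection from the set of centric cubes of $\hat{\mathcal X}$ with center $n_0$ onto the set of non-linear $4$-cliques of $\Gamma$; (c) a bijection from the set of centric dodecades of $\hat{\mathcal X}$ with center $n_0$ onto the set of non-linear $6$-cliques of $\Gamma$.
   Context: Let $q=2^n$, $V=V(6,q)$, and let $Q=Q^-(5,q)$ be the set of singular points of a non-degenerate quadratic form $f$ of Witt index $2$ on $V$, a generalized quadrangle of order $(q,q^2)$ whose lines are the totally singular lines; $\perp$ is the polarity defined by the bilinear form of $f$. Let $H_0$ be a hyperplane with $Q_0:=Q\cap H_0\cong Q(4,q)$ parabolic, and $n_0:=H_0^\perp$ (nucleus of $Q_0$, not on $Q$). An elliptic ovoid of $Q_0$ is $S\cap Q_0$ for a $3$-dimensional subspace $S$ of $H_0$ meeting $Q_0$ in an elliptic quadric; two distinct elliptic ovoids are tangent if they meet in exactly one point. A rosette based at $p\in Q_0$ is a set of $q$ elliptic ovoids pairwise meeting exactly in $\{p\}$. $\Gamma$: vertices the elliptic ovoids, adjacency = tangency; a clique is linear if contained in a rosette, non-linear otherwise. $\hat{\mathcal X}$ is the geometry with points $Q\setminus Q_0$ and lines $\hat l=l\setminus\{l\cap Q_0\}$ for lines $l$ of $Q$ not contained in $Q_0$; $\hat\Gamma$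 is its collinearity graph. $\varphi_0$ is the map $x\mapsto x^\perp\cap Q_0$ on points of $\hat{\mathcal X}$ (a $2$-fold covering of $\mathcal X$, the geometry of elliptic ovoids and rosettes). For $k\ge3$, a centric $2k$-configuration of $\hat{\mathcal X}$ with center $n_0$ is a set of $2k$ points $\{x_i^a: i=1,\dots,k,\ a=1,2\}$ of $Q\setminus Q_0$ such that $x_i^a$ and $x_j^b$ are adjacent in $\hat\Gamma$ iff $i\ne j$ and $a\ne b$, and for each $i$ the projective line through $x_i^1,x_i^2$ passes through $n_0$. It is called a centric hexagon, cube, decade, dodecade for $k=3,4,5,6$ respectively. *)

(* Defs.v *)
From HB Require Import structures.
From mathcomp Require Import all_boot all_order all_algebra all_fingroup.
Set Implicit Arguments. Unset Strict Implicit. Unset Printing Implicit Defensive.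
Import GRing.Theory.
Local Open Scope ring_scope.

Section Geometry.
Variable F : finFieldType.

(* Projective subspaces of PG(5,F) are represented by canonical square
   matrices (<<X>>%MS = X) whose row space is the vector subspace. *)
Definition pt := {X : 'M[F]_6 | (\rank X == 1)%N && (<<X>>%MS == X)}.

Variable A : 'M[F]_6.

Definition qf (v : 'rV[F]_6) : F := (v *m A *m v^T) 0 0.
(* polar bilinear form b(u,v) = f(u+v)-f(u)-f(v) = u (A + A^T) v^T *)
Definition bmx : 'M[F]_6 := A + A^T.
Definition perp (X : 'M[F]_6) : 'M[F]_6 := kermx (bmx *m X^T).

Definition tsing (X : 'M[F]_6) : bool :=
  [forall v : 'rV[F]_6, (v <= X)%MS ==> (qf v == 0)].
Definition nondeg_on (X : 'M[F]_6) : Prop :=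
  forall v : 'rV[F]_6, (v <= X)%MS -> (v <= perp X)%MS -> qf v = 0 -> v = 0.
Definition witt_index_on (X : 'M[F]_6) (k : nat) : Prop :=
  (exists Y : 'M[F]_6, [/\ (Y <= X)%MS, tsing Y & \rank Y = k]) /\
  (forall Y : 'M[F]_6, (Y <= X)%MS -> tsing Y -> (\rank Y <= k)%N).

Variable H0 : 'M[F]_6.

Definition onQ (p : pt) : bool := tsing (val p).
Definition onQ0 (p : pt) : bool := onQ p && (val p <= H0)%MS.
Definition n0 : 'M[F]_6 := perp H0.

Definition Xhat_pts : {set pt} := [set p | onQ p && ~~ (val p <= H0)%MS].
Definition hat_line (L : {set pt}) : Prop :=
  exists l : 'M[F]_6, [/\ \rank l = 2%N, tsing l, ~~ (l <= H0)%MS &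
    L = [set p : pt | (val p <= l)%MS && ~~ (val p <= H0)%MS]].
Definition hat_adj (x y : pt) : Prop :=
  x <> y /\ exists L, hat_line L /\ x \in L /\ y \in L.

(* automorphisms of hat-X (extended by arbitrary values outside hat-X) *)
Definition Xhat_aut (alpha : {perm pt}) : Prop :=
  alpha @: Xhat_pts = Xhat_pts /\
  forall L : {set pt}, hat_line L <-> hat_line (alpha @: L).

Definition ell_ovoid (O : {set pt}) : Prop :=
  exists S : 'M[F]_6, [/\ (S <= H0)%MS, \rank S = 4%N, nondeg_on S,
    witt_index_on S 1 & O = [set p : pt | onQ p && (val p <= S)%MS]].
Definition tangent (O1 O2 : {set pt}) : Prop :=
  [/\ ell_ovoid O1, ell_ovoid O2, O1 <> O2 & #|O1 :&: O2| = 1%N].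
Definition rosette (p : pt) (R : {set {set pt}}) : Prop :=
  [/\ onQ0 p, #|R| = #|F|,
      (forall O, O \in R -> ell_ovoid O) &
      (forall O1 O2, O1 \in R -> O2 \in R -> O1 <> O2 -> O1 :&: O2 = [set p])].
Definition clique (k : nat) (C : {set {set pt}}) : Prop :=
  [/\ #|C| = k, (forall O, O \in C -> ell_ovoid O) &
      (forall O1 O2, O1 \in C -> O2 \in C -> O1 <> O2 -> tangent O1 O2)].
Definition linear_clique (C : {set {set pt}}) : Prop :=
  exists p R, rosette p R /\ C \subset R.
Definition nonlinear_clique (k : nat) (C : {set {set pt}}) : Prop :=
  clique k C /\ ~ linear_clique C.

Definition centric (k : nat) (S : {set pt}) : Prop :=
  exists x : 'I_k -> bool -> pt,
  [/\ S = [set x i a | i : 'I_k, a : bool],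
      (forall i j a b, x i a = x j b -> i = j /\ a = b),
      (forall i a, x i a \in Xhat_pts),
      (forall i j a b, hat_adj (x i a) (x j b) <-> (i != j) && (a != b)) &
      (forall i, (n0 <= val (x i false) + val (x i true))%MS)].

Definition phi0 (x : pt) : {set pt} :=
  [set p : pt | onQ0 p && (val p <= perp (val x))%MS].

Definition induces_bij (phi : pt -> {set pt}) (k : nat) : Prop :=
  [/\ (forall S, centric k S -> nonlinear_clique k (phi @: S)),
      (forall S1 S2, centric k S1 -> centric k S2 -> phi @: S1 = phi @: S2 -> S1 = S2) &
      (forall C, nonlinear_clique k C -> exists2 S, centric k S & phi @: S = C)].

End Geometry.

(* Main.v *)
(* Let n span n0, scaled so that f(n) = 1; then H0 is the orthogonal of n.  Points of
   Q off H0 correspond to singular vectors v with b(v,n) = 1, and the fibre of phi0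
   through v is {v, v + n}.  Two such ovoids are tangent iff b(v,w) is 0 or 1, and
   passing from w to w + n exchanges the two values; three mutually orthogonal
   points lie on a line of Q, whose points off H0 give a rosette.  Hence a clique
   lifts to vectors with b(v_1,v_i) = 1 for i > 1, and a single further value 0
   forces all of it onto one line; a non-linear clique therefore lifts to vectors
   with all b(v_i,v_j) = 1, i.e. to a centric configuration.
   Finally, points x <> y are joined by a line through n0 iff they are neither
   collinear nor have a common neighbour, so automorphisms preserve centric
   configurations. *)

Require Import Defs.
From HB Require Import structures.
From mathcomp Require Import all_boot all_order all_algebra all_fingroup.
From mathcomp Require Import ring.
Set Implicit Arguments. Unset Strict Implicit. Unset Printing Implicit Defensive.
Import GRing.Theory.
Local Open Scope ring_scope.

(** * Square roots and Artin-Schreier classes in characteristic two *)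

Section CharacteristicTwo.
Variable F : finFieldType.
Hypothesis char2 : 2%N \in [pchar F].

(** Reduces an identity special to characteristic two to one valid in every commutative ring: [e] is
    half the difference of the two sides. *)
Lemma eq_mod2 (e x y : F) : x - y = 2%:R * e -> x = y.
Proof. by rewrite (pcharf0 char2) mul0r => /subr0_eq. Qed.

(** Squaring is injective because (y - z)^2 and y^2 - z^2 agree modulo 2, and an injective self-map
    of a finite set is onto. *)
Lemma sqrtF (x : F) : exists y, y ^+ 2 = x.
Proof.
have inj : injective (fun y : F => y ^+ 2).
  move=> y z /= E; apply/eqP; rewrite -subr_eq0 -sqrf_eq0; apply/eqP.
  by apply: (@eq_mod2 (z ^+ 2 - y * z)); ring: E.
by have /codomP[y ->] := injF_onto inj x; exists y.
Qed.

(* As [t |-> t^2 + t] is additive with kernel {0, 1}, its image has index 2; if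
   0, d, e were in distinct cosets, translating by them would embed three copies
   of F in two. *)
Lemma artin_schreier (d e : F) :
  exists t, [\/ t ^+ 2 + t = d, t ^+ 2 + t = e | t ^+ 2 + t = d + e].
Proof.
pose p t : F := t ^+ 2 + t.
have pD t s : p (t + s) = p t + p s.
  by apply: (@eq_mod2 (t * s)); rewrite /p; ring.
have [/existsP[t]|/existsPn nex] :=
  boolP [exists t, [|| p t == d, p t == e | p t == d + e]].
  by case/or3P=> /eqP <-; exists t; [constructor 1|constructor 2|constructor 3].
pose c (o : option bool) := if o is Some b then if b then d else e else 0.
(* The value of [p] determines t up to t + 1; the bit records which of the two comes first in the
   enumeration of [F] and so separates them. *)
pose g (x : option bool * F) :=
  (p x.2 + c x.1, (enum_rank x.2 < enum_rank (x.2 + 1)%R)%N).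
have nc t s (z : F) : p t = p s + z -> p (t - s) = z.
  move=> E; rewrite pD E; apply: (@eq_mod2 (p s - s)).
  by rewrite /p; ring.
have inj : injective g.
  move=> [o t] [o' s] /= [E1 E2].
  have Eo : o = o'.
    apply: contraTeq isT => neq.
    have [z [Hz Ez]] : exists z, [|| z == d, z == e | z == d + e] /\ p (t - s) = z.
      have two := addrr_pchar2 char2.
      exists (c o + c o'); split; last first.
        by apply: nc; rewrite -[LHS]addr0 -(two (c o)) addrA E1 -!addrA [c o' + _]addrC.
      case: o o' neq {E1} => [[]|] [[]|] //= _; rewrite ?add0r ?addr0 ?eqxx ?orbT //.
      by rewrite addrC eqxx !orbT.
    by move: (nex (t - s)); rewrite Ez Hz.
  rewrite -Eo in E1 *; congr (_, _).
  have : p (t - s) = 0 by apply: nc; rewrite addr0; apply: addIr E1.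
  rewrite /p expr2 -[X in _ + X]mulr1 -mulrDr => /eqP; rewrite mulf_eq0 => /orP[].
    by rewrite subr_eq0 => /eqP.
  rewrite addr_eq0 subr_eq (oppr_pchar2 char2) => /eqP Et.
  have Es : s = t + 1 by rewrite Et addrAC (addrr_pchar2 char2) add0r.
  have Et' : t = s + 1 by rewrite Et addrC.
  by move: E2; rewrite -Es -Et'; case: ltngtP => // /val_inj /enum_rank_inj.
have := leq_card g inj.
by rewrite !card_prod card_option card_bool mulnC leq_pmul2l // ; apply/card_gt0P; exists 0.
Qed.
End CharacteristicTwo.

(** * Adjoining a vector to a subspace *)

Lemma rank_adds_row (F : fieldType) m n (X : 'M[F]_(m, n)) (v : 'rV[F]_n) :
  ~~ (v <= X)%MS -> \rank (X + v)%MS = (\rank X).+1.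
Proof.
move=> nvX; apply/eqP; rewrite eqn_leq; apply/andP; split.
  apply: leq_trans (mxrank_adds_leqif _ _) _.
  by rewrite -[(\rank X).+1]addn1 leq_add2l rank_rV leq_b1.
by apply: rank_ltmx; rewrite ltmxE addsmxSl addsmx_sub submx_refl.
Qed.

Lemma sub_adds_rows (F : fieldType) n (u v w : 'rV[F]_n) :
  (w <= u + v)%MS -> exists a b, w = a *: u + b *: v.
Proof.
case/sub_addsmxP=> [[a b]] /= ->; exists (a 0 0), (b 0 0).
by rewrite {1}[a]mx11_scalar {1}[b]mx11_scalar !mul_scalar_mx.
Qed.

(** * The quadratic form and its polar form on row vectors *)

Section QuadraticForm.
Variables (F : finFieldType) (A : 'M[F]_6).
Implicit Types (u v w x y : 'rV[F]_6) (X Y U : 'M[F]_6).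

Definition bil u v : F := (u *m bmx A *m v^T) 0 0.

Lemma bilDl u v w : bil (u + v) w = bil u w + bil v w.
Proof. by rewrite /bil !mulmxDl mxE. Qed.
Lemma bilDr w u v : bil w (u + v) = bil w u + bil w v.
Proof. by rewrite /bil [(u + v)^T]linearD /= mulmxDr mxE. Qed.
Lemma bilZl a u v : bil (a *: u) v = a * bil u v.
Proof. by rewrite /bil -!scalemxAl mxE. Qed.
Lemma bilZr a u v : bil u (a *: v) = a * bil u v.
Proof. by rewrite /bil [(a *: v)^T]linearZ /= -scalemxAr mxE. Qed.
Lemma bilC u v : bil u v = bil v u.
Proof.
rewrite /bil -[in LHS](trmxK (u *m _ *m _)) mxE !trmx_mul trmxK.
by rewrite /bmx [(A + _)^T]linearD /= trmxK addrC -mulmxA.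
Qed.
Lemma bil0 u : bil u 0 = 0.
Proof. by rewrite -(scale0r 0) bilZr mul0r. Qed.
Definition bilE := (bilDl, bilDr, bilZl, bilZr).

Lemma qfD u v : qf A (u + v) = qf A u + qf A v + bil u v.
Proof.
have tr1 (M : 'M[F]_1) : M^T = M by apply/matrixP=> i j; rewrite mxE !ord1.
rewrite /qf /bil /bmx [(u + v)^T]linearD /= !(mulmxDr, mulmxDl).
rewrite -[v *m A *m u^T]tr1 !trmx_mul trmxK mulmxA ![(_ + _ : 'M_1) 0 0]mxE; ring.
Qed.
Lemma qfZ a u : qf A (a *: u) = a ^+ 2 * qf A u.
Proof.
rewrite /qf [(a *: u)^T]linearZ /= -scalemxAr -!scalemxAl.
by rewrite ![(_ *: _ : 'M_1) 0 0]mxE mulrA.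
Qed.
Lemma qf0 : qf A 0 = 0.
Proof. by rewrite -(scale0r 0) qfZ expr0n mul0r. Qed.
Lemma bil_qf u : bil u u = 2%:R * qf A u.
Proof.
apply: (@addrI _ (2%:R * qf A u)); have := qfD u u.
by rewrite -[u in u + u]scale1r -scalerDl qfZ => E; ring: E.
Qed.

Lemma perpP u X : reflect (forall w, (w <= X)%MS -> bil u w = 0) (u <= perp A X)%MS.
Proof.
rewrite /perp sub_kermx; apply: (iffP eqP) => [E w /submxP[D ->]|E].
  by rewrite /bil trmx_mul mulmxA -[u *m _ *m _]mulmxA E mul0mx mxE.
apply/rowP=> j; rewrite mulmxA [RHS]mxE -(E (row j X) (row_sub _ _)) /bil !mxE.
by apply: eq_bigr => i _; rewrite !mxE.
Qed.

Lemma perp_rowP u v : (u <= perp A <<v>>)%MS = (bil u v == 0).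
Proof.
apply/perpP/eqP=> [|E w]; first by apply; rewrite genmxE.
by rewrite genmxE => /sub_rVP[a ->]; rewrite bilZr E mulr0.
Qed.

Lemma perp_addsP u v w :
  (u <= perp A (v + w)%MS)%MS = (bil u v == 0) && (bil u w == 0).
Proof.
apply/perpP/andP=> [E|[/eqP Ev /eqP Ew] z].
  by split; rewrite E ?addsmxSl ?addsmxSr.
by case/sub_adds_rows=> a [b ->]; rewrite !bilE Ev Ew !mulr0 addr0.
Qed.

Lemma tsingP X : reflect (forall v, (v <= X)%MS -> qf A v = 0) (tsing A X).
Proof.
by apply: (iffP forallP) => H v; [move/(implyP (H v))/eqP | apply/implyP=> /H->].
Qed.

Lemma tsing_bil X u v : tsing A X -> (u <= X)%MS -> (v <= X)%MS -> bil u v = 0.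
Proof.
move=> /tsingP sX uX vX; have := sX (u + v) (addmx_sub uX vX).
by rewrite qfD !sX // !add0r.
Qed.

Lemma tsing_rowP v : tsing A <<v>>%MS = (qf A v == 0).
Proof.
apply/tsingP/eqP=> [|E w]; first by apply; rewrite genmxE.
by rewrite genmxE => /sub_rVP[a ->]; rewrite qfZ E mulr0.
Qed.

Lemma tsing_adds_rowP X v : tsing A X -> qf A v = 0 ->
  (forall w, (w <= X)%MS -> bil w v = 0) -> tsing A (X + v)%MS.
Proof.
move=> /tsingP sX sv bX; apply/tsingP=> w /sub_addsmxP[[a b]] /= ->.
rewrite [b]mx11_scalar mul_scalar_mx qfD qfZ sv bilZr bX ?submxMl //.
by rewrite sX ?submxMl // !mulr0 !addr0.
Qed.

Hypothesis char2 : 2%N \in [pchar F].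

Lemma bil_alt u : bil u u = 0.
Proof. by rewrite bil_qf (pcharf0 char2) mul0r. Qed.

(** When B(w, w') = 1, this is the component of [u] orthogonal to the plane of [w] and [w']; the
    plus signs are those of characteristic two. *)
Definition proj w w' u := u + bil u w' *: w + bil u w *: w'.

Lemma bil_projl w w' u : bil w w' = 1 -> bil (proj w w' u) w = 0.
Proof.
by move=> E; rewrite !bilE bil_alt [bil w' _]bilC E mulr0 mulr1 addr0 addrr_pchar2.
Qed.
Lemma bil_projr w w' u : bil w w' = 1 -> bil (proj w w' u) w' = 0.
Proof.
by move=> E; rewrite !bilE bil_alt E mulr0 mulr1 addr0 addrr_pchar2.
Qed.

Lemma qf_scale1 u : qf A u != 0 -> exists2 a, a != 0 & qf A (a *: u) = 1.
Proof.
move=> nz; have [a Ea] := sqrtF char2 (qf A u)^-1.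
exists a; last by rewrite qfZ Ea mulVf.
by apply: contraNneq nz => a0; rewrite -invr_eq0 -Ea a0 expr0n.
Qed.

(* Radical vectors of an even-dimensional subspace: hyperbolic planes are split
   off until the bilinear form vanishes, and then [qf] is semilinear, so it has a
   singular vector as soon as the dimension is at least 2. *)
Lemma nondeg_even_radical m U : \rank U = m.*2 -> nondeg_on A U ->
  forall u, (u <= U)%MS -> (forall w, (w <= U)%MS -> bil u w = 0) -> u = 0.
Proof.
elim: m U => [|m IH] U rU ndU u uU uperp.
  by move/eqP: rU; rewrite mxrank_eq0 => /eqP U0; apply/eqP; rewrite -submx0 -U0.
have ndU' x : (x <= U)%MS -> (forall w, (w <= U)%MS -> bil x w = 0) ->
    qf A x = 0 -> x = 0 by move=> xU /perpP; apply: ndU.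
have [/existsP[w /existsP[w' /and3P[wU w'U nz]]]|/existsPn iso] :=
  boolP [exists w, exists w', [&& (w <= U)%MS, (w' <= U)%MS & bil w w' != 0]].
  wlog E : w' w'U nz / bil w w' = 1.
    move=> WL; apply: (WL ((bil w w')^-1 *: w')); rewrite ?scalemx_sub // bilZr mulVf //.
    exact: oner_neq0.
  pose W := (w + w')%MS; pose U' := (U :&: perp A W)%MS.
  have WU : (W <= U)%MS by rewrite addsmx_sub wU.
  have rW : \rank W = 2%N.
    rewrite rank_adds_row ?rank_rV.
      by rewrite (_ : w != 0) //; apply: contraNneq nz => ->; rewrite bilC bil0.
    apply: contraNN nz => /sub_rVP[a ->]; by rewrite bilZr bil_alt mulr0.
  have U'P x : (x <= U')%MS = [&& (x <= U)%MS, bil x w == 0 & bil x w' == 0].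
    by rewrite sub_capmx perp_addsP.
  have dec x : (x <= U)%MS -> (proj w w' x <= U')%MS.
    move=> xU; rewrite U'P bil_projl ?bil_projr // eqxx andbT.
    by rewrite !addmx_sub ?scalemx_sub.
  have UE : (U :=: U' + W)%MS.
    apply/eqmxP; rewrite addsmx_sub capmxSl WU !andbT; apply/rV_subP=> x xU.
    have -> : x = proj w w' x - (bil x w' *: w + bil x w *: w').
      by rewrite /proj -[x + _ + _]addrA addrK.
    rewrite addmx_sub ?(submx_trans (dec _ xU)) ?addsmxSl // eqmx_opp.
    apply: submx_trans (addsmxSr _ _).
    by rewrite addmx_sub // scalemx_sub ?addsmxSl ?addsmxSr.
  have cap0 : (U' :&: W)%MS = 0.
    apply/eqP; rewrite -submx0; apply/rV_subP=> x.
    rewrite sub_capmx U'P => /andP[/and3P[_ /eqP b1 /eqP b2]].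
    case/sub_adds_rows=> a [b Ex]; move: b1 b2.
    rewrite Ex !bilE !bil_alt [bil w' w]bilC E !mulr0 !mulr1 add0r addr0 => -> ->.
    by rewrite !scale0r addr0 sub0mx.
  have rU' : \rank U' = m.*2.
    have := mxrank_sum_cap U' W; rewrite cap0 mxrank0 addn0 -UE rU rW doubleS -addn2.
    by move/addIn.
  (* A vector of [U'] orthogonal to [U'] is orthogonal to all of [U], so nondegeneracy passes from
     [U] to [U']. *)
  have radU' x : (x <= U')%MS -> (forall y, (y <= U')%MS -> bil x y = 0) ->
      forall y, (y <= U)%MS -> bil x y = 0.
    rewrite U'P => /and3P[xU /eqP b1 /eqP b2] xp y /dec/xp.
    by rewrite /proj !bilE b1 b2 !mulr0 !addr0.
  have uU' : (u <= U')%MS by rewrite U'P uU !uperp ?eqxx.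
  apply: (IH U' rU') => // [x xU' /perpP xp|y yU']; last first.
    by apply: uperp; apply: submx_trans yU' (capmxSl _ _).
  apply: ndU'; last exact: radU'.
  by apply: submx_trans xU' (capmxSl _ _).
have {}iso x y : (x <= U)%MS -> (y <= U)%MS -> bil x y = 0.
  move=> xU yU; have /existsPn/(_ y) := iso x.
  by rewrite xU yU /= negbK => /eqP.
pose x := nz_row U.
have xU : (x <= U)%MS by apply: nz_row_sub.
have [y [yU nyx]] : exists y, (y <= U)%MS /\ ~~ (y <= x)%MS.
  have /row_subPn[i ni] : ~~ (U <= x)%MS.
    by apply: contraTN (rank_leq_row x) => /mxrankS; rewrite rU -ltnNge; apply: leq_trans.
  by exists (row i U); rewrite row_sub.
(* This [a] makes a x + y singular; being radical it is then zero, contrary to the independence of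
   [x] and [y]. *)
have [a Ea] := sqrtF char2 (qf A y / qf A x).
have x0 : x != 0.
  by rewrite nz_row_eq0 -mxrank_eq0 rU.
have fx : qf A x != 0.
  apply: contraNneq x0 => fx; apply/eqP; apply: ndU' => // w; exact: iso.
have : a *: x + y = 0.
  apply: ndU'; first by rewrite addmx_sub ?scalemx_sub.
    by move=> w wU; rewrite !bilE !iso // mulr0 addr0.
  rewrite qfD qfZ Ea bilZl iso // mulr0 addr0 divfK //; exact: addrr_pchar2.
move/eqP; rewrite addr_eq0 => /eqP E; case/negP: nyx.
by rewrite -eqmx_opp -E scalemx_sub.
Qed.
End QuadraticForm.

(** * Singular vectors of a form of Witt index 2 *)

Section EllipticQuadric.
Variables (F : finFieldType) (A : 'M[F]_6).
Hypothesis char2 : 2%N \in [pchar F].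
Hypothesis ndV : forall v, (forall w, bil A v w = 0) -> v = 0.
Hypothesis wittV : witt_index_on A 1%:M 2.
Implicit Types (u v w x y z : 'rV[F]_6) (X Y U : 'M[F]_6).
Local Notation f := (qf A).
Local Notation B := (bil A).

Let two := addrr_pchar2 char2.

Lemma addr2_eq0 (x y : F) : (x + y == 0) = (x == y).
Proof. by rewrite addr_eq0 (oppr_pchar2 char2). Qed.

Lemma addv2 v : v + v = 0.
Proof. by rewrite -[v]scale1r -scalerDl two scale0r. Qed.

Lemma addv_eq v w : v + w = 0 -> v = w.
Proof. by move=> E; rewrite -[v]addr0 -(addv2 w) addrA E add0r. Qed.

Lemma bmx_unit : bmx A \in unitmx.
Proof.
rewrite -row_free_unit -kermx_eq0; apply/eqP/row_matrixP=> i; rewrite row0.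
apply: ndV => w; have /sub_kermxP E : (row i (kermx (bmx A)) <= kermx (bmx A))%MS.
  exact: row_sub.
by rewrite /bil E mul0mx mxE.
Qed.

Lemma rank_perp X : \rank (perp A X) = (6 - \rank X)%N.
Proof.
rewrite mxrank_ker -mxrank_tr trmx_mul trmxK mxrankMfree //.
by rewrite row_free_unit unitmx_tr bmx_unit.
Qed.

Lemma perp_perp X : (perp A (perp A X) :=: X)%MS.
Proof.
apply/eqmx_sym/eqmxP; have sub : (X <= perp A (perp A X))%MS.
  by apply/rV_subP=> v vX; apply/perpP=> w /perpP wX; rewrite bilC wX.
rewrite -(mxrank_leqif_eq sub) !rank_perp subKn //; exact: rank_leq_row.
Qed.

(** The three vectors would span a totally singular subspace of rank 3, above the Witt index. *)
Lemma no_singular_plane x y z : f x = 0 -> f y = 0 -> f z = 0 ->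
  B x y = 0 -> B x z = 0 -> B y z = 0 ->
  x != 0 -> ~~ (y <= x)%MS -> ~~ (z <= x + y)%MS -> False.
Proof.
move=> fx fy fz xy xz yz x0 yx zxy.
have t1 : tsing A <<x>>%MS by rewrite tsing_rowP fx.
have t2 : tsing A (<<x>> + y)%MS.
  apply: tsing_adds_rowP => // w; rewrite genmxE => /sub_rVP[a ->].
  by rewrite bilZl xy mulr0.
have E2 : (<<x>> + y :=: x + y)%MS by apply: adds_eqmx; [apply: genmxE|].
have : tsing A (<<x>> + y + z)%MS.
  apply: tsing_adds_rowP => // w; rewrite E2 => /sub_adds_rows[a [b ->]].
  by rewrite !bilE xz yz !mulr0 addr0.
move/(proj2 wittV _ (submx1 _)).
rewrite rank_adds_row ?E2 // rank_adds_row //.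
by rewrite rank_rV x0.
Qed.

(** A totally singular subspace [Y] of rank 2 contains a vector orthogonal to [v] and not
    proportional to it, since orthogonality to [v] is a single linear condition. Adding a multiple
    of [v] keeps it singular and makes it orthogonal to [w]. *)
Lemma singular_perp_pair v w : f v = 0 -> f w = 0 -> B v w != 0 ->
  exists u, [/\ u != 0, f u = 0, B u v = 0 & B u w = 0].
Proof.
move=> fv fw vw; have [[Y [_ tY rY]] _] := wittV.
have [y [yY yv Byv]] : exists y, [/\ (y <= Y)%MS, ~~ (y <= v)%MS & B y v = 0].
  have [vY|nvY] := boolP (v <= Y)%MS.
    have /row_subPn[i ni] : ~~ (Y <= v)%MS.
      by apply: contraTN (rank_leq_row v) => /mxrankS; rewrite rY -ltnNge.
    by exists (row i Y); rewrite row_sub (tsing_bil tY) ?row_sub.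
  pose Z := (Y :&: perp A <<v>>)%MS.
  have rZ : \rank Z != 0%N.
    have := mxrank_mul_ker Y (bmx A *m <<v>>%MS^T); rewrite -/(perp A _) -/Z rY.
    have := mxrankM_maxr Y (bmx A *m <<v>>%MS^T).
    have := mxrankM_maxr (bmx A) <<v>>%MS^T.
    rewrite mxrank_tr genmxE; have := rank_leq_row v.
    case: (\rank Z) => // h1 h2 h3; rewrite addn0 => E.
    by move: (leq_trans h3 (leq_trans h2 h1)); rewrite E.
  have := nz_row_sub Z; rewrite sub_capmx perp_rowP => /andP[zY /eqP zv].
  exists (nz_row Z); split=> //; apply: contra nvY => /sub_rVP[a Ea].
  have a0 : a != 0.
    by apply: contraNneq rZ => a0; rewrite mxrank_eq0 -nz_row_eq0 Ea a0 scale0r.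
  by rewrite -[v](scalerK a0) -Ea scalemx_sub.
exists (y + (B y w / B v w) *: v); split.
- apply: contraNneq yv => /addv_eq ->; exact: scalemx_sub.
- by rewrite qfD (elimT (tsingP A Y) tY y yY) qfZ fv bilZr Byv !mulr0 !addr0.
- by rewrite !bilE Byv bil_alt // mulr0 addr0.
- by rewrite !bilE divfK // two.
Qed.

Lemma bil_partner u : u != 0 -> exists w, B u w = 1.
Proof.
move=> u0; have [/existsP[w nz]|/existsPn zero] := boolP [exists w, B u w != 0].
  by exists ((B u w)^-1 *: w); rewrite bilZr mulVf.
by case/eqP: u0; apply: ndV => w; apply/eqP; rewrite -[_ == _]negbK zero.
Qed.

(* The singular vectors orthogonal to a hyperbolic pair span its orthogonal. *)
Lemma perp_singular_perp v w z : f v = 0 -> f w = 0 -> B v w = 1 ->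
  (forall u, f u = 0 -> B u v = 0 -> B u w = 0 -> B z u = 0) ->
  z = B z w *: v + B z v *: w.
Proof.
move=> fv fw vw Hz.
have [u [u0 fu uv uw]] : exists u, [/\ u != 0, f u = 0, B u v = 0 & B u w = 0].
  by apply: singular_perp_pair; rewrite // vw oner_neq0.
have [s0 Bs0] := bil_partner u0; pose s := proj A v w s0.
have [sv sw] : B s v = 0 /\ B s w = 0 by rewrite bil_projl ?bil_projr.
have us : B u s = 1 by rewrite !bilE uv uw Bs0 !mulr0 !addr0.
(* If B(t, u) is nonzero, adding a multiple of the singular vector [u] makes [t] singular, so the
   hypothesis on [z] applies. *)
clearbody s; have zt1 t : B t v = 0 -> B t w = 0 -> B t u != 0 -> B z t = 0.
  move=> tv tw tu; have := Hz (t + (f t / B t u) *: u).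
  rewrite !bilE tv tw uv uw (Hz u) // !mulr0 !addr0; apply=> //.
  by rewrite qfD qfZ fu bilZr divfK // mulr0 addr0 two.
have zt t : B t v = 0 -> B t w = 0 -> B z t = 0.
  move=> tv tw; have [tu|] := eqVneq (B t u) 0; last exact: zt1.
  have su : B s u = 1 by rewrite bilC.
  (* Both summands pair to 1 with [u], which brings [t] back to the previous case. *)
  have -> : t = (t + s) + s by rewrite -addrA addv2 addr0.
  have nz1 := oner_neq0 F.
  by rewrite bilDr !zt1 ?addr0 ?bilDl ?tv ?tw ?sv ?sw ?tu ?su ?addr0 ?add0r.
(* The component of [z] orthogonal to [v] and [w] is orthogonal to every vector, hence zero. *)
apply: addv_eq; rewrite addrA -/(proj A v w z); apply: ndV => t.
have -> : t = (B t w *: v + B t v *: w) + proj A v w t.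
  by rewrite addrC /proj -[t + _ + _]addrA -addrA addv2 addr0.
have := bil_projl char2 t vw; have := bil_projr char2 t vw.
have := bil_projl char2 z vw; have := bil_projr char2 z vw.
move: (proj A v w t) => t'; move: (erefl (proj A v w z)).
rewrite {1}/proj; move: (proj A v w z) => z' Ez' z'w z'v t'w t'v.
rewrite 2!bilDr !bilZr z'v z'w !mulr0 !add0r -Ez' 2!bilDl !bilZl zt //.
by rewrite [B v _]bilC [B w _]bilC t'v t'w !mulr0 !addr0.
Qed.
End EllipticQuadric.

(** * Singular vectors normalized against the nucleus *)

Section NormalizedVectors.
Variables (F : finFieldType) (A : 'M[F]_6).
Hypothesis char2 : 2%N \in [pchar F].
Hypothesis ndV : forall v, (forall w, bil A v w = 0) -> v = 0.
Hypothesis wittV : witt_index_on A 1%:M 2.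
Variable n : 'rV[F]_6.
Hypothesis qn : qf A n = 1.
Implicit Types (u v w x y z : 'rV[F]_6) (X Y U : 'M[F]_6).
Local Notation f := (qf A).
Local Notation B := (bil A).

Let two := addrr_pchar2 char2.
Let addv2' := addv2 char2.
Let Balt := bil_alt A char2.

(* Points of Q off the hyperplane [n^perp] are spanned by a unique such vector. *)
Definition normalized v := f v = 0 /\ B v n = 1.

(** Here f(v + n) = f(v) + f(n) + B(v, n) = 0 + 1 + 1. This shift exchanges the two points above an
    ovoid. *)
Lemma normalized_addn v : normalized v -> normalized (v + n).
Proof.
by case=> fv vn; split; rewrite ?qfD ?bilDl ?fv ?qn ?vn ?Balt ?addr0 ?add0r ?two.
Qed.

Lemma normalized_neq0 v : normalized v -> v != 0.
Proof. by case=> _ vn; apply: contra_eq_neq vn => ->; rewrite bilC bil0 eq_sym oner_eq0. Qed.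

Lemma sqr_add_eq0 (c : F) : (c ^+ 2 + c == 0) = (c == 0) || (c == 1).
Proof. by rewrite expr2 -[X in _ + X]mulr1 -mulrDr mulf_eq0 (addr2_eq0 char2). Qed.

(** If [s] were not a multiple of [r], then [r], [s], [v] would span a singular plane: [v] is
    outside the span of [r] and [s], because only [v] pairs nontrivially with [n]. *)
Lemma singular_perp_unique v r s : normalized v -> f r = 0 -> f s = 0 ->
  B r v = 0 -> B s v = 0 -> B r n = 0 -> B s n = 0 -> B r s = 0 ->
  r != 0 -> exists t, s = t *: r.
Proof.
move=> [fv vn] fr fs rv sv rn sn rs r0; apply/sub_rVP; apply/negPn/negP=> sr.
apply: (no_singular_plane wittV fr fs fv rs rv sv r0 sr).
apply/negP=> /sub_adds_rows[a [b E]]; move/eqP: vn; rewrite E !bilE rn sn !mulr0 addr0.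
by rewrite eq_sym oner_eq0.
Qed.

(** The vectors [v] and v + n form a hyperbolic pair, so [perp_singular_perp] puts [w] in their
    span. Then w = v + c n, and f(w) = c^2 + c leaves only c = 0 and c = 1. *)
Lemma perp_separates v w : normalized v -> normalized w ->
  (forall u, f u = 0 -> B u v = 0 -> B u n = 0 -> B u w = 0) ->
  w = v \/ w = v + n.
Proof.
move=> [fv vn] [fw wn] H.
have [fvn vnn] : normalized (v + n) by apply: normalized_addn.
have Bvv : B v (v + n) = 1 by rewrite bilDr Balt vn add0r.
have := @perp_singular_perp F A char2 ndV wittV v (v + n) w fv fvn Bvv.
have Hu u : f u = 0 -> B u v = 0 -> B u (v + n) = 0 -> B w u = 0.
  by move=> fu uv; rewrite bilDr uv add0r [B w u]bilC; apply: H.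
move/(_ Hu); rewrite bilDr wn; set c := B w v => E.
have {}E : w = v + c *: n.
  by rewrite E scalerDl scale1r scalerDr addrACA -scalerDl two scale0r add0r.
move/eqP: fw; rewrite E qfD qfZ fv qn bilZr vn add0r !mulr1 sqr_add_eq0.
by case/orP=> /eqP->; [left; rewrite scale0r addr0|right; rewrite scale1r].
Qed.

Section Pair.
Variables v w : 'rV[F]_6.
Hypotheses (nv : normalized v) (nw : normalized w).
Let c := B v w.

(* Spans the radical of <v, w, n>; it is the base point when the ovoids of [v] and
   [w] are tangent. *)
Definition base_vec := v + w + B v w *: n.

(** The value c^2 + c vanishes exactly for c = 0 or 1, which is where these two values in the
    tangency criterion come from. *)
Lemma base_vec_perp : [/\ B base_vec v = 0, B base_vec w = 0,
  B base_vec n = 0 & f base_vec = c ^+ 2 + c].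
Proof.
have [fv vn] := nv; have [fw wn] := nw.
rewrite /base_vec !qfD qfZ fv fw qn !bilE !Balt [B w v]bilC vn wn [B n v]bilC vn [B n w]bilC wn.
rewrite -/c !mulr0 !mulr1 !add0r !addr0 !two; split=> //.
by rewrite addr0 addrC.
Qed.

Lemma tangent_perp u : c = 0 \/ c = 1 -> base_vec != 0 ->
  f u = 0 -> B u v = 0 -> B u w = 0 -> B u n = 0 -> exists t, u = t *: base_vec.
Proof.
move=> c01 r0 fu uv uw un; have [rv rw rn fr] := base_vec_perp.
apply: (singular_perp_unique nv) => //.
  by rewrite fr; case: c01 => ->; rewrite ?expr0n ?expr1n ?addr0 ?two.
by rewrite bilC /base_vec !bilE uv uw un mulr0 !addr0.
Qed.

(** If some [s] orthogonal to [v], [w], [n] is not orthogonal to [u], a combination of [s] and [u]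
    is a second singular vector. Otherwise [u] lies in the span of [v], [w], [n], hence is a
    multiple of [base_vec], which is not singular for this [c]. *)
Lemma secant_perp u : c != 0 -> c != 1 ->
  u != 0 -> f u = 0 -> B u v = 0 -> B u w = 0 -> B u n = 0 ->
  exists u', [/\ ~~ (u' <= u)%MS, f u' = 0, B u' v = 0, B u' w = 0 & B u' n = 0].
Proof.
move=> c0 c1 u0 fu uv uw un; have [rv rw rn fr] := base_vec_perp.
have [/existsP[s /and4P[us /eqP sv /eqP sw /eqP sn]]|/existsPn H] :=
  boolP [exists s, [&& B u s != 0, B s v == 0, B s w == 0 & B s n == 0]].
  exists (s + (f s / B u s) *: u); split.
  - apply: contra us; case/sub_rVP=> a /(congr1 (B u)).
    by rewrite !bilDr !bilZr Balt !mulr0 addr0 => ->.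
  - by rewrite qfD qfZ fu bilZr [B s u]bilC divfK // mulr0 addr0 two.
  - by rewrite bilDl bilZl sv uv mulr0 addr0.
  - by rewrite bilDl bilZl sw uw mulr0 addr0.
  - by rewrite bilDl bilZl sn un mulr0 addr0.
have : (u <= v + w + n)%MS.
  rewrite -(perp_perp ndV); apply/perpP=> s /perpP Hs.
  apply/eqP; apply/negPn; apply: contra (H s) => -> /=.
  have sub1 : (v + w <= v + w + n)%MS by apply: addsmxSl.
  rewrite !Hs ?eqxx ?addsmxSr // (submx_trans _ sub1) ?addsmxSl ?addsmxSr //.
case/sub_addsmxP=> [[D1 D2]] /= E.
have [a [b Eab]] := sub_adds_rows (submxMl D1 (v + w)%MS).
have [e Ee] := sub_rVP (submxMl D2 n); move: E; rewrite Eab Ee => E.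
have [fv vn] := nv; have [fw wn] := nw.
have ba : b = a.
  apply/esym/eqP; rewrite -(addr2_eq0 char2) -un E !bilE vn wn Balt.
  by rewrite !mulr1 mulr0 addr0.
have ea : e = a * c.
  apply/esym/eqP; rewrite -(addr2_eq0 char2) -uv E !bilE Balt [B w v]bilC [B n v]bilC vn.
  by rewrite ba mulr0 add0r mulr1.
have Er : u = a *: base_vec by rewrite E ba ea /base_vec !scalerDr scalerA.
move/eqP: fu; rewrite Er qfZ fr mulf_eq0 sqr_add_eq0 (negPf c0) (negPf c1) !orbF.
by rewrite sqrf_eq0 => /eqP a0; case/eqP: u0; rewrite Er a0 scale0r.
Qed.

(** Write n = a v + b w. Then B(n, n) = 0 gives a = b, B(v, n) = 1 gives a c = 1, and f(n) = 1 gives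
    a^2 c = 1, so a = 1. *)
Lemma sub_span_antipodal : (n <= v + w)%MS -> w = v + n.
Proof.
have [fv vn] := nv; have [fw wn] := nw.
case/sub_adds_rows=> a [b E].
have ba : b = a.
  apply/esym/eqP; rewrite -(addr2_eq0 char2); apply/eqP.
  by move: (Balt n); rewrite {1}E !bilE vn wn !mulr1.
have ac : a * c = 1 by rewrite -vn E !bilE Balt mulr0 add0r ba.
have aac : a * (a * c) = 1.
  by rewrite -qn E ba qfD !qfZ fv fw !bilE !mulr0 !add0r.
have a1 : a = 1 by rewrite -aac ac mulr1.
by rewrite E ba a1 !scale1r addrA addv2' add0r.
Qed.

(** If no such [z] existed, [n] would be orthogonal to all singular vectors orthogonal to [v] and
    [w]. By [perp_singular_perp] it would lie in their span, making [w] equal to v + n. *)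
Lemma common_neighbour : c != 0 -> w != v + n ->
  exists z, [/\ normalized z, B z v = 0 & B z w = 0].
Proof.
move=> c0 ne; have [fv vn] := nv; have [fw wn] := nw.
have [/existsP[z /and4P[zn /eqP fz /eqP zv /eqP zw]]|/existsPn H] :=
  boolP [exists z, [&& B z n != 0, f z == 0, B z v == 0 & B z w == 0]].
  exists ((B z n)^-1 *: z); split; first split.
  - by rewrite qfZ fz mulr0.
  - by rewrite bilZl mulVf.
  - by rewrite bilZl zv mulr0.
  - by rewrite bilZl zw mulr0.
case/eqP: ne; apply: sub_span_antipodal.
rewrite (@perp_singular_perp F A char2 ndV wittV v (c^-1 *: w) n) //.
- by rewrite addmx_sub ?scalerA ?scalemx_sub ?addsmxSl ?addsmxSr.
- by rewrite qfZ fw mulr0.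
- by rewrite bilZr mulVf.
move=> u fu uv; rewrite bilZr => /eqP; rewrite mulf_eq0 invr_eq0 (negPf c0) /= => /eqP uw.
rewrite bilC; apply/eqP/negPn/negP=> un; have := H u.
by rewrite un fu uv uw eqxx.
Qed.
End Pair.

(* A generalized quadrangle has no triangles. *)
Lemma triangle_collinear v w z : normalized v -> normalized w -> normalized z ->
  v != w -> B v w = 0 -> B v z = 0 -> B w z = 0 -> exists t, z = v + t *: (v + w).
Proof.
move=> [fv vn] [fw wn] [fz zn] ne vw vz wz.
have ne' : v + w != 0 by apply: contraNneq ne => /(addv_eq char2) ->.
(* The sums v + w and v + z are orthogonal to [n], singular, and orthogonal to [v] and to each
   other, hence proportional. *)
have [||||||||//|t Et] := @singular_perp_unique v (v + w) (v + z).
all: rewrite ?qfD ?bilDl ?bilDr ?Balt ?[B w v]bilC ?[B z v]bilC ?fv ?fw ?fz ?vw ?vz ?wz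
  ?vn ?wn ?zn ?addr0 ?two //.
by exists t; rewrite -Et addrA addv2' add0r.
Qed.
End NormalizedVectors.

(** * Projective points and their spanning vectors *)

Section Points.
Variable F : finFieldType.
Implicit Types (u v w : 'rV[F]_6) (p : pt F).

Lemma pt_of_subproof v : let X := <<if v == 0 then delta_mx 0 0 else v>>%MS in
  (\rank X == 1)%N && (<<X>>%MS == X).
Proof.
rewrite /= !genmx_id eqxx andbT mxrank_gen rank_rV; case: ifP => [_|->//].
by rewrite -rank_rV mxrank_delta.
Qed.
(* The zero vector is sent to an arbitrary point. *)
Definition pt_of v : pt F :=
  exist (fun X : 'M[F]_6 => is_true ((\rank X == 1)%N && (<<X>>%MS == X)))
    _ (pt_of_subproof v).

Lemma val_pt_of v : v != 0 -> val (pt_of v) = <<v>>%MS.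
Proof. by move=> nz; rewrite /= (negPf nz). Qed.

Lemma pt_of_vec p : exists2 v, v != 0 & p = pt_of v.
Proof.
have /andP[/eqP r1 /eqP g] := valP p.
have nz : nz_row (val p) != 0 by rewrite nz_row_eq0 -mxrank_eq0 r1.
exists (nz_row (val p)) => //; apply: val_inj; rewrite val_pt_of // -[LHS]g.
apply/esym/genmxP; rewrite -(mxrank_leqif_eq (nz_row_sub _)).
by rewrite rank_rV nz r1.
Qed.

Lemma pt_of_eq u v : u != 0 -> v != 0 -> (pt_of u == pt_of v) = (u <= v)%MS.
Proof.
move=> u0 v0; rewrite -val_eqE !val_pt_of //; apply/eqP/idP=> [|uv].
  by move/genmxP/andP=> [].
by apply/genmxP; rewrite -(mxrank_leqif_eq uv) !rank_rV u0 v0.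
Qed.

Lemma pt_of_sub u (X : 'M[F]_6) : u != 0 -> (val (pt_of u) <= X)%MS = (u <= X)%MS.
Proof. by move=> u0; rewrite val_pt_of // genmxE. Qed.
End Points.

(** * Elliptic ovoids as images of normalized vectors *)

Section Ovoids.
Variables (F : finFieldType) (A H0 : 'M[F]_6).
Hypothesis char2 : 2%N \in [pchar F].
Hypothesis ndV : forall v, (forall w, bil A v w = 0) -> v = 0.
Hypothesis wittV : witt_index_on A 1%:M 2.
Variable n : 'rV[F]_6.
Hypothesis qn : qf A n = 1.
Hypothesis H0E : forall v : 'rV_6, (v <= H0)%MS = (bil A v n == 0).
Hypothesis n0E : (n0 A H0 :=: n)%MS.
Implicit Types (u v w x y z : 'rV[F]_6) (X Y U : 'M[F]_6) (p : pt F).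
Local Notation f := (qf A).
Local Notation B := (bil A).
Local Notation normalized := (normalized A n).
Local Notation Xhat := (Xhat_pts A H0).
Local Notation phi0 := (phi0 A H0).

Let two := addrr_pchar2 char2.
Let Balt := bil_alt A char2.
Let nz v : normalized v -> v != 0 := @normalized_neq0 F A n v.

Lemma onQ_pt_of u : u != 0 -> onQ A (pt_of u) = (f u == 0).
Proof. by move=> u0; rewrite /onQ val_pt_of // tsing_rowP. Qed.

Lemma XhatP p : reflect (exists2 v, normalized v & p = pt_of v) (p \in Xhat).
Proof.
rewrite inE; apply: (iffP idP) => [|[v nv ->]]; last first.
  case: (nv) => fv vn; rewrite onQ_pt_of ?pt_of_sub ?nz // fv eqxx H0E vn.
  exact: oner_neq0.
have [u u0 ->] := pt_of_vec p; rewrite onQ_pt_of // pt_of_sub // H0E => /andP[/eqP fu un].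
exists ((B u n)^-1 *: u); first by split; rewrite ?qfZ ?fu ?mulr0 // bilZl mulVf.
apply/eqP; rewrite pt_of_eq //; last by rewrite scaler_eq0 invr_eq0 negb_or un.
by rewrite -{1}[u](scalerKV un) scalemx_sub.
Qed.

Lemma pt_of_Xhat v : normalized v -> pt_of v \in Xhat.
Proof. by move=> nv; apply/XhatP; exists v. Qed.

Lemma pt_of_inj v w : normalized v -> normalized w -> pt_of v = pt_of w -> v = w.
Proof.
move=> nv nw /eqP; rewrite pt_of_eq ?nz // => /sub_rVP[a E].
by case: nv nw => _ vn [_ wn]; move: vn; rewrite E bilZl wn mulr1 => ->; rewrite scale1r.
Qed.

Lemma in_phi0 u v : u != 0 -> normalized v ->
  (pt_of u \in phi0 (pt_of v)) = [&& f u == 0, B u n == 0 & B u v == 0].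
Proof.
move=> u0 nv; rewrite inE /onQ0 onQ_pt_of // !pt_of_sub // H0E.
by rewrite (val_pt_of (nz nv)) perp_rowP andbA.
Qed.

Lemma hat_adj_bil v w : normalized v -> normalized w ->
  hat_adj A H0 (pt_of v) (pt_of w) <-> v != w /\ B v w = 0.
Proof.
move=> nv nw; split=> [[ne [L [[l [rl tl _ ->]]]]]|[ne vw]].
  rewrite !inE !pt_of_sub ?nz // => [[/andP[vl _] /andP[wl _]]].
  split; last exact: tsing_bil tl vl wl.
  by apply/eqP=> E; apply: ne; rewrite E.
have [fv vn] := nv; have [fw wn] := nw.
split; first by move/(pt_of_inj nv nw)/eqP; rewrite (negPf ne).
pose l := (<<v>> + w)%MS.
have vl : (v <= l)%MS by rewrite (submx_trans _ (addsmxSl _ _)) // genmxE.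
have wl : (w <= l)%MS by apply: addsmxSr.
have vH : ~~ (v <= H0)%MS by rewrite H0E vn oner_neq0.
have wH : ~~ (w <= H0)%MS by rewrite H0E wn oner_neq0.
exists [set p : pt F | (val p <= l)%MS && ~~ (val p <= H0)%MS]; split; last first.
  by rewrite !inE !pt_of_sub ?nz // vl wl vH wH.
exists l; split=> //.
- rewrite rank_adds_row genmxE; last first.
    apply: contra ne => wv; apply/eqP/(pt_of_inj nv nw)/esym/eqP.
    by rewrite pt_of_eq ?nz.
  by rewrite rank_rV nz.
- apply: tsing_adds_rowP => //; first by rewrite tsing_rowP fv.
  by move=> z; rewrite genmxE => /sub_rVP[a ->]; rewrite bilZl vw mulr0.
- by apply: contra vH; apply: submx_trans.
Qed.

Lemma antipodal_n0 v w : normalized v -> normalized w ->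
  (n0 A H0 <= val (pt_of v) + val (pt_of w))%MS <-> w = v + n.
Proof.
move=> nv nw; rewrite !val_pt_of ?nz // n0E.
have E : (<<v>> + <<w>> :=: v + w)%MS by apply: adds_eqmx; apply: genmxE.
rewrite E; split; first exact: (sub_span_antipodal char2 qn nv nw).
move=> ->; have {1}-> : n = v + (v + n) by rewrite addrA addv2 // add0r.
by rewrite addmx_sub ?addsmxSl ?addsmxSr.
Qed.

(** This is the two-fold covering: points of an ovoid are orthogonal to [n], so [v] and v + n cut
    out the same one, and [perp_separates] excludes any other coincidence. *)
Lemma phi0_eq v w : normalized v -> normalized w ->
  phi0 (pt_of v) = phi0 (pt_of w) <-> w = v \/ w = v + n.
Proof.
move=> nv nw; split=> [E|].
  apply: (perp_separates char2 ndV wittV qn nv nw) => u fu uv un.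
  have [->|u0] := eqVneq u 0; first by rewrite bilC bil0.
  have : pt_of u \in phi0 (pt_of v) by rewrite in_phi0 // fu uv un !eqxx.
  by rewrite E in_phi0 // => /and3P[_ _ /eqP].
case=> -> //; apply/setP=> p; have [u u0 ->] := pt_of_vec p.
rewrite !in_phi0 //; last exact: normalized_addn.
by case: eqP => //= _; rewrite bilDr; case: eqP => //= ->; rewrite addr0.
Qed.

(** Here [base_vec] is v + w or v + w + n, nonzero by the two inequalities, and [tangent_perp] shows
    that it spans the only common point. *)
Lemma phi0_tangent v w : normalized v -> normalized w -> w != v -> w != v + n ->
  B v w = 0 \/ B v w = 1 ->
  base_vec A n v w != 0 /\ phi0 (pt_of v) :&: phi0 (pt_of w) = [set pt_of (base_vec A n v w)].
Proof.
move=> nv nw ne ne' c01.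
have [rv rw rn fr] := base_vec_perp char2 qn nv nw.
have r0 : base_vec A n v w != 0.
  case: c01 => c; rewrite /base_vec c ?scale0r ?scale1r ?addr0.
    by apply: contraNneq ne => /(addv_eq char2) ->.
  by apply: contraNneq ne'; rewrite addrAC => /(addv_eq char2) ->.
split=> //; apply/setP=> p; have [u u0 ->] := pt_of_vec p.
rewrite in_setI in_set1 !in_phi0 // pt_of_eq //; apply/idP/idP.
  case/andP=> /and3P[/eqP fu /eqP un /eqP uv] /and3P[_ _ /eqP uw]; apply/sub_rVP.
  exact: (tangent_perp char2 wittV qn nv nw c01).
case/sub_rVP=> a ->; rewrite qfZ !bilZl rv rw rn fr !mulr0 !eqxx !andbT /= andbb.
by case: c01 => ->; rewrite ?expr0n ?expr1n /= ?addr0 ?two mulr0.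
Qed.

(** For any other value of B(v, w), [secant_perp] produces a second common point from the first. *)
Lemma tangent_bil v w : normalized v -> normalized w ->
  #|phi0 (pt_of v) :&: phi0 (pt_of w)| = 1%N -> B v w = 0 \/ B v w = 1.
Proof.
move=> nv nw /eqP/cards1P[p E]; have [u u0 Ep] := pt_of_vec p.
have inE' x : x != 0 -> [&& f x == 0, B x n == 0, B x v == 0 & B x w == 0] = (x <= u)%MS.
  move=> x0; rewrite -pt_of_eq // -Ep -[pt_of x == p]in_set1 -E in_setI !in_phi0 //.
  by case: (f x == 0) (B x n == 0) (B x v == 0) => [] [] [].
have := inE' u u0; rewrite submx_refl => /and4P[/eqP fu /eqP un /eqP uv /eqP uw].
have [->|c0] := eqVneq (B v w) 0; first by left.
have [->|c1] := eqVneq (B v w) 1; first by right.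
have [x [xu fx xv xw xn]] := secant_perp char2 ndV qn nv nw c0 c1 u0 fu uv uw un.
case/negP: (xu); rewrite -inE' ?fx ?xv ?xw ?xn ?eqxx //.
by apply: contraNneq xu => ->; apply: sub0mx.
Qed.

Lemma rank_pair v : normalized v -> \rank (v + n)%MS = 2%N.
Proof.
move=> nv; rewrite rank_adds_row ?rank_rV ?nz //.
apply/negP=> /sub_rVP[a E]; have := Balt n; rewrite {1}E bilZl (proj2 nv) mulr1 => a0.
by move/eqP: qn; rewrite E a0 scale0r qf0 eq_sym oner_eq0.
Qed.

Lemma ovoid_of_perp v : normalized v ->
  phi0 (pt_of v) = [set p : pt F | onQ A p && (val p <= perp A (v + n)%MS)%MS].
Proof.
move=> nv; apply/setP=> p; have [u u0 ->] := pt_of_vec p.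
by rewrite in_phi0 // inE onQ_pt_of // pt_of_sub // perp_addsP [_ && (B u n == 0)]andbC.
Qed.

(** The subspace is the orthogonal of [v] and [n]. Its Witt index is at most 1, since adjoining [v]
    to a totally singular subspace of it gives a larger one; [singular_perp_pair] for [v] and v + n
    supplies a singular vector. *)
Lemma ell_ovoid_phi0 v : normalized v -> ell_ovoid A H0 (phi0 (pt_of v)).
Proof.
move=> nv; have [fv vn] := nv; have [fvn vnn] := normalized_addn char2 qn nv.
exists (perp A (v + n)%MS); split.
- by apply/rV_subP=> u; rewrite perp_addsP H0E => /andP[].
- by rewrite (rank_perp ndV) rank_pair.
- move=> u; rewrite perp_addsP (perp_perp ndV) => /andP[/eqP uv /eqP un].
  case/sub_adds_rows=> a [b E] _; move: uv un.
  rewrite E !bilE !Balt vn [B n v]bilC vn !mulr0 !mulr1 add0r addr0 => -> ->.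
  by rewrite !scale0r addr0.
- split; last first.
    move=> Y YS tY; have := proj2 wittV (Y + v)%MS (submx1 _).
    rewrite rank_adds_row ?ltnS; last first.
      apply/negP=> /submx_trans/(_ YS); rewrite perp_addsP vn => /andP[_].
      by rewrite oner_eq0.
    apply; apply: tsing_adds_rowP => // w wY.
    by have := submx_trans wY YS; rewrite perp_addsP => /andP[/eqP].
  have vvn : B v (v + n) = 1 by rewrite bilDr Balt add0r.
  have := @singular_perp_pair F A char2 wittV v (v + n) fv fvn.
  rewrite vvn oner_neq0 => /(_ isT)[u [u0 fu uv]]; rewrite bilDr uv add0r => un.
  exists <<u>>%MS; rewrite mxrank_gen rank_rV u0 tsing_rowP fu eqxx; split=> //.
  by rewrite genmxE perp_addsP uv un eqxx.
- exact: ovoid_of_perp.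
Qed.

(* If the line S^perp were anisotropic, so would be the orthogonal of a hyperbolic
   plane in S.  Both are then norm forms, whose sum has a totally singular plane,
   and V would have Witt index 3. *)
Lemma ell_ovoidP O : ell_ovoid A H0 O -> exists2 v, normalized v & O = phi0 (pt_of v).
Proof.
case=> S [SH rS ndS wS ->].
have radS := @nondeg_even_radical F A char2 2 S rS ndS.
have partner x : (x <= S)%MS -> x != 0 -> exists2 y, (y <= S)%MS & B x y = 1.
  move=> xS x0; have [/existsP[y /andP[yS xy]]|/existsPn H] :=
    boolP [exists y, (y <= S)%MS && (B x y != 0)].
    by exists ((B x y)^-1 *: y); rewrite ?scalemx_sub // bilZr mulVf.
  case/eqP: x0; apply: radS => // y yS; have := H y.
  by rewrite yS negbK => /eqP.
have Sn x : (x <= S)%MS -> B x n = 0.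
  by move=> /submx_trans/(_ SH); rewrite H0E => /eqP.
(* If [n] were orthogonal to all of S^perp, it would lie in S; being orthogonal to S as well, it
   would be a radical vector of S. *)
have [a a_perp an] : exists2 a, (a <= perp A S)%MS & B a n = 1.
  have [/existsP[y /andP[yS xy]]|/existsPn H] :=
    boolP [exists y, (y <= perp A S)%MS && (B y n != 0)].
    by exists ((B y n)^-1 *: y); rewrite ?scalemx_sub // bilZl mulVf.
  suff n_0 : n = 0 by move/eqP: qn; rewrite n_0 qf0 eq_sym oner_eq0.
  apply: radS; last by move=> x xS; rewrite bilC Sn.
  rewrite -(perp_perp ndV); apply/perpP=> y yS; have := H y.
  by rewrite yS negbK bilC => /eqP.
have aS x : (x <= S)%MS -> B x a = 0 by move=> xS; rewrite bilC (perpP _ _ _ a_perp).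
have [[Y [YS tY rY]] w1] := wS.
have [u [u0 fu uS]] : exists u, [/\ u != 0, f u = 0 & (u <= S)%MS].
  exists (nz_row Y); split; first by rewrite nz_row_eq0 -mxrank_eq0 rY.
    by apply: (elimT (tsingP A Y) tY); apply: nz_row_sub.
  exact: submx_trans (nz_row_sub _) YS.
have [u' u'S uu'] := partner u uS u0.
(* A singular [z] orthogonal to [u] and [u'] would span with [u] a totally singular line inside
   S. *)
have aniso z : (z <= S)%MS -> B z u = 0 -> B z u' = 0 -> z != 0 -> f z != 0.
  move=> zS zu zu' z0; apply/negP=> /eqP fz.
  have := w1 (<<u>> + z)%MS; rewrite rank_adds_row; last first.
    rewrite genmxE; apply/negP=> /sub_rVP[k E]; move: zu'.
    rewrite E bilZl uu' mulr1 => k0; case/eqP: z0; by rewrite E k0 scale0r.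
  rewrite mxrank_gen rank_rV u0 addsmx_sub genmxE uS zS => /(_ isT).
  move=> H; suff /H : tsing A (<<u>> + z)%MS by [].
  apply: tsing_adds_rowP => //; first by rewrite tsing_rowP fu.
  by move=> y; rewrite genmxE => /sub_rVP[k ->]; rewrite bilZl bilC zu mulr0.
have [b [bS bu bu' fb]] : exists b, [/\ (b <= S)%MS, B b u = 0, B b u' = 0 & f b = 1].
  pose Z := (S :&: perp A (u + u')%MS)%MS.
  have Z0 : Z != 0.
    have le2 : (\rank (u + u')%MS <= 2)%N.
      rewrite (leq_trans (mxrank_adds_leqif _ _)) // !rank_rV.
      by apply: (@leq_add _ _ 1 1); apply: leq_b1.
    have le6 := rank_leq_col (S + perp A (u + u')%MS)%MS.
    rewrite -mxrank_eq0; apply: contraTneq le6 => Z0.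
    have := mxrank_sum_cap S (perp A (u + u')%MS).
    rewrite Z0 addn0 rS (rank_perp ndV) => ->.
    by case: (\rank _) le2 => [|[|[|]]].
  have := nz_row_sub Z; rewrite sub_capmx perp_addsP => /and3P[zS /eqP zu /eqP zu'].
  have z0 : nz_row Z != 0 by rewrite nz_row_eq0.
  have [k _ fk] := qf_scale1 char2 (aniso _ zS zu zu' z0).
  by exists (k *: nz_row Z); rewrite scalemx_sub // !bilZl zu zu' mulr0.
have b0 : b != 0.
  by apply/eqP=> E; move/eqP: fb; rewrite E qf0 eq_sym oner_eq0.
have [b' [b'S b'u b'u' bb']] :
    exists b', [/\ (b' <= S)%MS, B b' u = 0, B b' u' = 0 & B b b' = 1].
  have [b1 b1S bb1] := partner b bS b0.
  exists (proj A u u' b1); rewrite bil_projl ?bil_projr //; split=> //.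
    by rewrite /proj !addmx_sub ?scalemx_sub.
  by rewrite /proj !bilDr !bilZr bu bu' bb1 !mulr0 !addr0.
have b'b : B b' b = 1 by rewrite bilC.
have [t Ht] := artin_schreier char2 (f a) (f b').
(* For such [t], the vector a + t n is normalized and orthogonal to S, and a rank count identifies S
   with the orthogonal of it and [n]. *)
suff Ed : t ^+ 2 + t = f a.
  have nv : normalized (a + t *: n).
    split; last by rewrite bilDl bilZl Balt mulr0 addr0.
    by rewrite qfD qfZ qn bilZr an !mulr1 -addrA Ed two.
  exists (a + t *: n); rewrite ?ovoid_of_perp //.
  have vS x : (x <= S)%MS -> B x (a + t *: n) = 0.
    by move=> xS; rewrite bilDr bilZr (aS x xS) (Sn x xS) mulr0 addr0.
  move: (a + t *: n) nv vS => v nv vS.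
  have sub : (S <= perp A (v + n)%MS)%MS.
    by apply/rV_subP=> x xS; rewrite perp_addsP vS ?Sn ?eqxx.
  have E : (S :=: perp A (v + n)%MS)%MS.
    by apply/eqmxP; rewrite -(mxrank_leqif_eq sub) (rank_perp ndV) rank_pair // rS.
  by apply/setP=> p; rewrite !inE E.
(* If t^2 + t = f(b'), then b' + t b is singular and contradicts [aniso]. *)
case: Ht => // E; exfalso.
  have fz : f (b' + t *: b) = 0 by rewrite qfD qfZ fb bilZr b'b !mulr1 -addrA E two.
  have z0 : b' + t *: b != 0.
    apply/eqP=> z0; have := bil0 A b; rewrite -z0 bilDr bilZr Balt bb' mulr0 addr0.
    by move/eqP; rewrite oner_eq0.
  have := aniso (b' + t *: b); rewrite fz eqxx.
  rewrite !bilDl !bilZl b'u b'u' bu bu' mulr0 addr0 addmx_sub ?scalemx_sub //.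
  by move=> /(_ isT erefl erefl z0).
have [an' bn b'n] : [/\ B n a = 1, B n b = 0 & B n b' = 0] by rewrite bilC an ![B n _]bilC !Sn.
have [ab ab' ba] : [/\ B a b = 0, B a b' = 0 & B b a = 0] by rewrite ![B a _]bilC !aS.
(* In the last case f(a + b' + t b) = 0, f(n + b) = 1 + 1 = 0, and these two vectors are orthogonal
   because B(n, a) + B(b, b') = 1 + 1. *)
apply: (@no_singular_plane F A wittV u (n + b) (a + (b' + t *: b))) => //.
- by rewrite qfD qn fb bn addr0 two.
- rewrite !qfD qfZ fb !bilE ab ab' b'b mulr0 !mulr1 !addr0.
  by rewrite -[f b' + _ + _]addrA [f a + _]addrA -E two.
- by rewrite bilDr Sn // bilC bu addr0.
- by rewrite !bilE aS // ![B u _]bilC b'u bu mulr0 !addr0.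
- by rewrite !bilE an' bn b'n ba bb' Balt !mulr0 !add0r !addr0 two.
- apply/negP=> /sub_rVP[k /(congr1 (B b'))]; rewrite bilDr bilZr b'u b'b mulr0 bilC b'n.
  by rewrite add0r => /eqP; rewrite oner_eq0.
- apply/negP=> /sub_adds_rows[k [l /(congr1 (B b))]].
  rewrite !bilE ba bb' Balt bu [B b n]bilC bn !(mulr0, addr0, add0r) => /eqP.
  by rewrite oner_eq0.
Qed.
End Ovoids.

(** * Automorphisms and collinearity *)

Lemma imset_permKV (T : finType) (s : {perm T}) (X : {set T}) :
  s @: ((s^-1)%g @: X) = X.
Proof. by rewrite -imset_comp (eq_imset _ (permKV s)) imset_id. Qed.

Section Automorphisms.
Variables (F : finFieldType) (A H0 : 'M[F]_6).
Implicit Types (x y z p : pt F) (al : {perm pt F}).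

Lemma Xhat_aut_inv al : Xhat_aut A H0 al -> Xhat_aut A H0 (al^-1)%g.
Proof.
case=> aX aL; split=> [|L]; last first.
  by have := aL ((al^-1)%g @: L); rewrite imset_permKV => E; split=> /E.
by rewrite -{1}aX -imset_comp (eq_imset _ (permK al)) imset_id.
Qed.

Lemma aut_Xhat al x : Xhat_aut A H0 al -> x \in Xhat_pts A H0 -> al x \in Xhat_pts A H0.
Proof. by case=> aX _ xX; rewrite -aX imset_f. Qed.

Lemma hat_adj_aut al x y : Xhat_aut A H0 al ->
  hat_adj A H0 (al x) (al y) <-> hat_adj A H0 x y.
Proof.
have half be x' y' : Xhat_aut A H0 be -> hat_adj A H0 x' y' -> hat_adj A H0 (be x') (be y').
  case=> _ bL [ne [L [lL [xL yL]]]]; split; first by move/perm_inj.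
  exists (be @: L); rewrite !imset_f //; split; [exact: (bL L).1 | by []].
move=> Ha; split; last exact: half.
by move/(half _ _ _ (Xhat_aut_inv Ha)); rewrite !permK.
Qed.

Lemma hat_adj_Xhat x y : hat_adj A H0 x y -> y \in Xhat_pts A H0.
Proof.
case=> _ [_ [[l [_ /tsingP tl _ ->]] [_]]]; rewrite !inE => /andP[yl ->].
by rewrite andbT; apply/tsingP=> v vy; apply: tl; apply: submx_trans yl.
Qed.
End Automorphisms.

(** * Centric configurations and non-linear cliques *)

Section Main.
Variables (F : finFieldType) (A H0 : 'M[F]_6).
Hypothesis char2 : 2%N \in [pchar F].
Hypothesis ndV : forall v, (forall w, bil A v w = 0) -> v = 0.
Hypothesis wittV : witt_index_on A 1%:M 2.
Variable n : 'rV[F]_6.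
Hypothesis qn : qf A n = 1.
Hypothesis H0E : forall v : 'rV_6, (v <= H0)%MS = (bil A v n == 0).
Hypothesis n0E : (n0 A H0 :=: n)%MS.
Implicit Types (u v w x y z : 'rV[F]_6) (p : pt F) (S : {set pt F}) (C : {set {set pt F}}).
Local Notation f := (qf A).
Local Notation B := (bil A).
Local Notation normalized := (normalized A n).
Local Notation Xhat := (Xhat_pts A H0).
Local Notation phi0 := (phi0 A H0).

Let two := addrr_pchar2 char2.
Let Balt := bil_alt A char2.
Let adjE := hat_adj_bil H0E.
Let antiE := antipodal_n0 char2 qn n0E.
Let phi0E := phi0_eq char2 ndV wittV qn H0E.
Let normn := normalized_addn char2 qn.

(** The right-hand side speaks of collinearity only, so automorphisms preserve it. A common
    neighbour z of v and v + n would satisfy B(z, n) = 0, and [common_neighbour] gives the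
    converse. *)
Lemma antipodalP (p q : pt F) : p \in Xhat -> q \in Xhat -> p <> q ->
  (n0 A H0 <= val p + val q)%MS <->
  ~ hat_adj A H0 p q /\ ~ exists r, hat_adj A H0 p r /\ hat_adj A H0 q r.
Proof.
move=> /(XhatP H0E)[v nv ->] /(XhatP H0E)[w nw ->] ne; rewrite antiE //.
have [fv vn] := nv; have [fw wn] := nw.
split=> [Ew|[nadj ncom]].
  split; first by move/adjE=> [] // _ /eqP; rewrite Ew bilDr Balt vn add0r oner_eq0.
  case=> r [ar br]; have /(XhatP H0E)[z nz' Er] := hat_adj_Xhat ar; move: ar br.
  rewrite Er !adjE // => [[_ vz] [_ /eqP]].
  by rewrite Ew bilDl vz add0r bilC (proj2 nz') oner_eq0.
apply/eqP/negPn/negP=> nw'.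
have vw0 : B v w != 0.
  apply/eqP=> vw0; apply: nadj; apply/adjE => //; split=> //.
  by apply/eqP=> E; apply: ne; rewrite E.
have [z [nz' zv zw]] := common_neighbour char2 ndV wittV qn nv nw vw0 nw'.
apply: ncom; exists (pt_of z); rewrite !adjE // ![B _ z]bilC zv zw; do !split=> //.
  by apply: contra_neq vw0 => ->.
by apply: contra_neq vw0 => ->; rewrite bilC.
Qed.

Lemma centric_aut k S (al : {perm pt F}) :
  Xhat_aut A H0 al -> centric A H0 k S -> centric A H0 k (al @: S).
Proof.
move=> Ha [x [-> inj xX adj anti]]; have aX p : p \in Xhat -> al p \in Xhat by apply: aut_Xhat.
exists (fun i a => al (x i a)); split=> [|i j a b /perm_inj/inj//|i a|i j a b|i].
- apply/setP=> p; apply/imsetP/imset2P=> [[q /imset2P[i a _ _ ->] ->]|[i a _ _ ->]].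
    by exists i a.
  by exists (x i a) => //; apply/imset2P; exists i a.
- exact: aX.
- by rewrite hat_adj_aut.
have ne : x i false <> x i true by move/inj=> [].
have ane : al (x i false) <> al (x i true) by move/perm_inj.
apply/(antipodalP (aX _ (xX _ _)) (aX _ (xX _ _)) ane).
have /(antipodalP (xX _ _) (xX _ _) ne)[nadj ncom] := anti i.
split; first by rewrite hat_adj_aut.
case=> r; rewrite -(permKV al r) !hat_adj_aut // => H; by apply: ncom; exists ((al^-1)%g r).
Qed.

(** One representative is kept from each antipodal pair. The last condition keeps the pairs
    distinct, since B(v, v + n) = 1 as well. *)
Definition centric_vectors k (v : 'I_k -> 'rV[F]_6) :=
  [/\ forall i, normalized (v i), forall i j, i != j -> B (v i) (v j) = 1
    & forall i j, i != j -> v i != v j + n].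

Definition sheet v (a : bool) := if a then v + n else v.

Lemma normalized_sheet v a : normalized v -> normalized (sheet v a).
Proof. by case: a => // /normn. Qed.

Lemma centricP k S : centric A H0 k S <->
  exists2 v, centric_vectors v & S = [set pt_of (sheet (v i) a) | i : 'I_k, a : bool].
Proof.
split=> [[x [-> inj xX adj anti]]|[v [nv v1 vn] ->]].
  have /fin_all_exists2[v nv xv] : forall i, exists2 v, normalized v & x i false = pt_of v.
    by move=> i; exact/(XhatP H0E).
  have xE i a : x i a = pt_of (sheet (v i) a).
    case: a => //=; have /(XhatP H0E)[w nw E] := xX i true.
    by have := anti i; rewrite xv E antiE // => ->.
  exists v; last first.
    by apply/setP=> p; apply/imset2P/imset2P=> -[i a _ _ ->]; exists i a.
  split=> // i j ij.
    (* Adjacency of v_i with v_j + n says B(v_i, v_j) + 1 = 0. *)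
    have /adj : (i != j) && (false != true) by rewrite ij.
    rewrite !xE adjE; [|exact: normalized_sheet..].
    move=> [_] /=; rewrite bilDr (proj2 (nv i)) => /eqP.
    by rewrite (addr2_eq0 char2) => /eqP.
  apply: contra ij => /eqP E; apply/eqP.
  by have [] : i = j /\ false = true by apply: inj; rewrite !xE /= E.
exists (fun i a => pt_of (sheet (v i) a)).
have nvs i a : normalized (sheet (v i) a) by apply: normalized_sheet.
have vI i j a b : sheet (v i) a = sheet (v j) b -> i = j /\ a = b.
  have [<-|ij] := eqVneq i j.
    have vin : v i <> v i + n.
      move/(congr1 (B (v i))); rewrite bilDr Balt (proj2 (nv i)) add0r => /eqP.
      by rewrite eq_sym oner_eq0.
    by move: a b => [] [] //= E; case: vin; rewrite E.
  have ij' : v i <> v j.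
    by move=> E; have /eqP := v1 i j ij; rewrite E Balt eq_sym oner_eq0.
  move: a b => [] [] //= E.
  - by case: ij'; apply: addIr E.
  - have ji : j != i by rewrite eq_sym.
    by case/eqP: (vn _ _ ji).
  - by case/eqP: (vn _ _ ij).
split=> // [i j a b /pt_of_inj E|i a|i j a b|i].
- by apply: vI; apply: E.
- exact: (pt_of_Xhat H0E).
- rewrite adjE //; have [<-|ij] /= := eqVneq i j.
    split=> // [[ne]]; case: a b ne => [] []; rewrite /= ?eqxx // => _ /eqP.
      by rewrite bilDl Balt [B n _]bilC (proj2 (nv i)) add0r oner_eq0.
    by rewrite bilDr Balt (proj2 (nv i)) add0r oner_eq0.
  split.
    case=> _; case: a b => [] [] //= /eqP.
      rewrite bilDl !bilDr Balt v1 // (proj2 (nv i)) [B n _]bilC (proj2 (nv j)).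
      by rewrite two addr0 add0r oner_eq0.
    by rewrite v1 // oner_eq0.
  move=> ab; split; first by apply: contra ij => /eqP/vI[->].
  case: a b ab => [] [] //= _.
    by rewrite bilDl v1 // [B n _]bilC (proj2 (nv j)) two.
  by rewrite bilDr v1 // (proj2 (nv i)) two.
- exact/(antiE (nvs i false) (nvs i true)).
Qed.

Lemma phi0_sheet v a : normalized v -> phi0 (pt_of (sheet v a)) = phi0 (pt_of v).
Proof. by move=> nv; case: a => //; apply/esym/phi0E => //=; [apply: normn|right]. Qed.

Lemma phi0_centric k (v : 'I_k -> 'rV[F]_6) : (forall i, normalized (v i)) ->
  phi0 @: [set pt_of (sheet (v i) a) | i : 'I_k, a : bool]
  = [set phi0 (pt_of (v i)) | i : 'I_k].
Proof.
move=> nv; apply/setP=> O; apply/imsetP/imsetP=> [[p /imset2P[i a _ _ ->] ->]|[i _ ->]].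
  by exists i; rewrite // phi0_sheet.
by exists (pt_of (v i)) => //; apply/imset2P; exists i false.
Qed.

(** In a rosette the base vectors of (v_0, v_1) and (v_0, v_2) would be proportional. The first is
    orthogonal to v_1, whereas the second pairs with v_1 to 1 + 1 + 1 = 1. *)
Lemma centric_nonlinear k S : (3 <= k)%N ->
  centric A H0 k S -> nonlinear_clique A H0 k (phi0 @: S).
Proof.
move=> k3 /centricP[v [nv v1 vn] ->]; rewrite phi0_centric //.
pose O i := phi0 (pt_of (v i)).
have ne i j : i != j -> v j != v i.
  move=> ij; apply: contra_eq_neq (v1 i j ij) => ->.
  by rewrite Balt eq_sym oner_eq0.
have Oinj : injective O.
  move=> i j /phi0E[] //; first by move/eqP; apply: contraTeq => /ne.
  by move/eqP; apply: contraTeq; rewrite eq_sym => /vn.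
have Otan i j : i != j -> base_vec A n (v i) (v j) != 0 /\
    O i :&: O j = [set pt_of (base_vec A n (v i) (v j))].
  move=> ij; apply: (phi0_tangent char2 wittV qn H0E) => //; first exact: ne.
    by apply: vn; rewrite eq_sym.
  by right; apply: v1.
have ell i : ell_ovoid A H0 (O i) by apply: (ell_ovoid_phi0 char2 ndV wittV qn H0E).
split; first split.
- by rewrite card_imset // card_ord.
- by move=> _ /imsetP[i _ ->]; apply: ell.
- move=> _ _ /imsetP[i _ ->] /imsetP[j _ ->] neO.
  split; [exact: ell|exact: ell|by []|].
  have /Otan[_ ->] : i != j by apply: contra_not_neq neO => ->.
  exact: cards1.
case=> p [R [[_ _ _ Rint] /subsetP CR]].
have OR i : O i \in R by apply: CR; apply: imset_f.
pose i0 := Ordinal (ltn_trans (isT : 0 < 2)%N k3).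
pose i1 := Ordinal (ltn_trans (isT : 1 < 2)%N k3).
pose i2 := Ordinal k3.
have O1 := Rint _ _ (OR i0) (OR i1) ltac:(by move/Oinj).
have O2 := Rint _ _ (OR i0) (OR i2) ltac:(by move/Oinj).
have [r1 E1] := Otan i0 i1 isT; have [r2 E2] := Otan i0 i2 isT.
have /sub_rVP[a Ea] : (base_vec A n (v i0) (v i1) <= base_vec A n (v i0) (v i2))%MS.
  by rewrite -pt_of_eq //; apply/eqP/set1_inj; rewrite -E1 -E2 O1 O2.
have [_ Bv _ _] := base_vec_perp char2 qn (nv i0) (nv i1).
move: Bv; rewrite Ea bilZl /base_vec !bilE !v1 // [B n _]bilC (proj2 (nv i1)) mulr1.
rewrite two add0r mulr1 => a0; case/eqP: r1; by rewrite Ea a0 scale0r.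
Qed.

(** A centric configuration contains both points of each fibre it meets, so it is the full preimage
    of its image. *)
Lemma centric_phi0_inj k S1 S2 : centric A H0 k S1 -> centric A H0 k S2 ->
  phi0 @: S1 = phi0 @: S2 -> S1 = S2.
Proof.
have K S : centric A H0 k S -> S = [set p in Xhat | phi0 p \in phi0 @: S].
  move=> /centricP[v [nv _ _] ->]; apply/setP=> p; rewrite [RHS]inE.
  apply/idP/andP=> [pS|[/(XhatP H0E)[w nw ->]]].
    split; last exact: imset_f.
    case/imset2P: pS => i a _ _ ->; apply: (pt_of_Xhat H0E); exact: normalized_sheet.
  rewrite phi0_centric // => /imsetP[i _ /esym/phi0E[] // ->]; apply/imset2P.
    by exists i false.
  by exists i true.
by move=> /K E1 /K E2 E; rewrite E1 E2 E.
Qed.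

(** The vectors a + t (a + b) represent the points off [H0] of the line through [a] and [b], which
    meets [H0] in a + b. Any two are orthogonal, with difference a multiple of a + b, so all
    tangency points agree. *)
Lemma line_rosette a b : normalized a -> normalized b -> a != b -> B a b = 0 ->
  rosette A H0 (pt_of (a + b)) [set phi0 (pt_of (a + t *: (a + b))) | t : F].
Proof.
move=> na nb ab Bab; have [fa an] := na; have [fb bn] := nb.
set r := a + b.
have r0 : r != 0 by apply: contraNneq ab => /(addv_eq char2) ->.
have fr : f r = 0 by rewrite qfD fa fb Bab !addr0.
have rn : B r n = 0 by rewrite bilDl an bn two.
have ar : B a r = 0 by rewrite bilDr Balt Bab addr0.
clearbody r; have nt t : normalized (a + t *: r).
  by split; rewrite ?qfD ?qfZ ?bilDl ?bilZl ?bilZr ?fa ?fr ?ar ?rn ?mulr0 ?addr0.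
(* Equality would make [n] a multiple of the singular vector [r], although f(n) = 1. *)
have tn t s : a + t *: r != a + s *: r + n.
  apply/eqP; rewrite -addrA => /addrI /eqP; rewrite [X in _ == X]addrC -subr_eq -scalerBl.
  move=> /eqP/(congr1 f); rewrite qn qfZ fr mulr0 => /eqP.
  by rewrite eq_sym oner_eq0.
have tr t s : a + t *: r = a + s *: r -> t = s.
  move=> /addrI /eqP; rewrite -subr_eq0 -scalerBl scaler_eq0 (negPf r0) orbF subr_eq0.
  by move/eqP.
split.
- by rewrite /onQ0 onQ_pt_of // pt_of_sub // H0E fr rn !eqxx.
- rewrite card_imset // => t s /phi0E[] // => [/tr //|/eqP]; by rewrite (negPf (tn _ _)).
- by move=> _ /imsetP[t _ ->]; apply: (ell_ovoid_phi0 char2 ndV wittV qn H0E).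
move=> _ _ /imsetP[t _ ->] /imsetP[s _ ->] ne.
have st : t != s by apply: contra_not_neq ne => ->.
have Bts : B (a + t *: r) (a + s *: r) = 0.
  by rewrite !bilE !Balt ar [B r a]bilC ar !mulr0 !addr0.
have sne : a + s *: r != a + t *: r by apply: contra_neq st => /tr.
have [b0 ->] :=
  phi0_tangent char2 wittV qn H0E (nt t) (nt s) sne (tn s t) (or_introl Bts).
congr [set _]; apply/eqP; rewrite pt_of_eq // /base_vec Bts scale0r addr0.
by rewrite addrACA (addv2 char2) add0r -scalerDl scalemx_sub.
Qed.

Lemma nonlinear_centric k C : (3 <= k)%N -> nonlinear_clique A H0 k C ->
  exists2 S, centric A H0 k S & phi0 @: S = C.
Proof.
move=> k3 [[cC ell tan] nonlin]; subst k.
pose O (i : 'I_#|C|) := enum_val i.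
have OC i : O i \in C by apply: enum_valP.
have OCE : [set O i | i : 'I_#|C|] = C.
  apply/setP=> X; apply/imsetP/idP=> [[i _ ->]//|XC].
  by exists (enum_rank_in XC X); rewrite // /O enum_rankK_in.
have /fin_all_exists2[v0 nv0 Ov0] i : exists2 v, normalized v & O i = phi0 (pt_of v).
  exact: (ell_ovoidP char2 ndV wittV qn H0E) (ell _ (OC i)).
pose i0 : 'I_#|C| := Ordinal (ltn_trans (isT : 0 < 2)%N k3).
(* Each lift is shifted by [n] when it is orthogonal to the lift of index [i0]; this leaves the
   ovoids unchanged. *)
have [v nv [Ov vi0]] : exists2 v, forall i, normalized (v i) &
    (forall i, O i = phi0 (pt_of (v i))) /\ (forall i, i != i0 -> B (v i0) (v i) != 0).
  exists (fun i => sheet (v0 i) ((i != i0) && (B (v0 i0) (v0 i) == 0))).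
    by move=> i; apply: normalized_sheet.
  split=> [i|i ii0]; first by rewrite phi0_sheet.
  rewrite /sheet eqxx ii0 /=; have [E|nz0] := eqVneq (B (v0 i0) (v0 i)) 0; last by [].
  by rewrite bilDr E (proj2 (nv0 i0)) add0r oner_neq0.
have Oinj : injective O := enum_val_inj.
have ne i j : i != j -> v i != v j.
  by apply: contra_neq => E; apply: Oinj; rewrite !Ov E.
have nen i j : i != j -> v i != v j + n.
  by apply: contra_neq => E; apply: Oinj; rewrite !Ov; apply/esym/phi0E; rewrite ?E; auto.
have v01 i j : i != j -> B (v i) (v j) = 0 \/ B (v i) (v j) = 1.
  move=> ij; apply: (tangent_bil char2 ndV qn H0E) => //; rewrite -!Ov.
  have [] // := tan _ _ (OC i) (OC j).
  by move/Oinj/eqP; rewrite (negPf ij).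
have {}vi0 i : i != i0 -> B (v i0) (v i) = 1.
  move=> ii0; have := vi0 i ii0; case: (v01 i0 i) => [|->|//]; first by rewrite eq_sym.
  by rewrite eqxx.
have [/existsP[i /existsP[j /andP[ij /eqP vij]]]|/existsPn all1] :=
  boolP [exists i, exists j, (i != j) && (B (v i) (v j) == 0)]; last first.
  exists [set pt_of (sheet (v i) a) | i : 'I_#|C|, a : bool].
    apply/centricP; exists v => //; split=> // i j ij.
    case: (v01 i j ij) => // E; have /existsPn/(_ j) := all1 i.
    by rewrite ij E eqxx.
  by rewrite phi0_centric // -[RHS]OCE; apply: eq_imset => i; rewrite Ov.
have i_i0 : i != i0.
  apply: contra_eq_neq vij => ei; rewrite ei vi0 ?oner_neq0 //.
  by rewrite -ei eq_sym.
have j_i0 : j != i0.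
  by apply: contra_eq_neq vij => ->; rewrite bilC vi0 ?oner_neq0.
(* The other lift of the ovoid [i0] is orthogonal to every other v_m, so [a], v_i and v_j are
   collinear; this line carries the rosette. *)
case: nonlin; pose a := v i0 + n.
have na : normalized a by apply: normn.
have a_perp m : m != i0 -> B a (v m) = 0.
  by move=> mi0; rewrite bilDl vi0 // [B n _]bilC (proj2 (nv m)) two.
have abi : a != v i by rewrite eq_sym nen.
have [t vj] := triangle_collinear char2 wittV na (nv i) (nv j) abi (a_perp i i_i0)
  (a_perp j j_i0) vij.
have t0 : t != 0.
  by apply: contraTneq (nen j i0 j_i0) => t0; rewrite vj t0 scale0r addr0 eqxx.
have t1 : t != 1.
  apply: contraTneq (ne i j ij) => t1; rewrite vj t1 scale1r addrA (addv2 char2) add0r.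
  by rewrite eqxx.
exists (pt_of (a + v i)), [set phi0 (pt_of (a + t *: (a + v i))) | t : F].
split; first exact: line_rosette (a_perp i i_i0).
rewrite -OCE; apply/subsetP=> _ /imsetP[m _ ->]; rewrite Ov; apply/imsetP.
have [->|mi0] := eqVneq m i0.
  exists 0 => //; rewrite scale0r addr0; apply/phi0E => //; by right.
suff [s ->] : exists s, v m = a + s *: (a + v i) by exists s.
have [im|mi] := eqVneq i m.
  by exists 1; rewrite scale1r addrA (addv2 char2) add0r im.
apply: (triangle_collinear char2 wittV na (nv i) (nv m) abi); rewrite ?a_perp //.
have [//|im1] := v01 i m mi.
(* Were B(v_i, v_m) = 1, then B(v_j, v_m) would equal [t], which is neither 0 nor 1. *)
have mj : j != m.
  by apply: contra_eq_neq im1 => <-; rewrite vij eq_sym oner_neq0.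
clearbody a; have := v01 j m mj.
rewrite vj bilDl bilZl bilDl a_perp // im1 !add0r mulr1.
by case=> /eqP; [rewrite (negPf t0)|rewrite (negPf t1)].
Qed.

(** Automorphisms and their inverses carry centric configurations to centric configurations, so the
    claim reduces to [phi0] alone. *)
Lemma induces_bij_phi0_aut k (al : {perm pt F}) : (3 <= k)%N -> Xhat_aut A H0 al ->
  induces_bij A H0 (fun p => phi0 (al p)) k.
Proof.
move=> k3 Ha; have im S : [set phi0 (al p) | p in S] = phi0 @: (al @: S).
  by rewrite -imset_comp.
split=> [S cS|S1 S2 c1 c2|C /(nonlinear_centric k3)[S cS <-]].
- by rewrite im; apply: centric_nonlinear => //; apply: centric_aut.
- rewrite !im => /centric_phi0_inj E; apply: (imset_inj (@perm_inj _ al)).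
  by apply: (E k); apply: centric_aut.
exists ((al^-1)%g @: S); first by apply: centric_aut => //; apply: Xhat_aut_inv.
by rewrite im imset_permKV.
Qed.
End Main.

(** * Normalization of the nucleus, and the cases of 3, 4 and 6 ovoids *)

Theorem theorem3 (F : finFieldType) (A H0 : 'M[F]_6) (alpha : {perm pt F}) :
  2%N \in [pchar F] ->
  nondeg_on A 1%:M -> witt_index_on A 1%:M 2 ->
  \rank H0 = 5%N -> nondeg_on A H0 ->
  Xhat_aut A H0 alpha ->
  let phi := fun x => phi0 A H0 (alpha x) in
  [/\ induces_bij A H0 phi 3, induces_bij A H0 phi 4 & induces_bij A H0 phi 6].
Proof.
move=> char2 nd1 wittV rH ndH Ha phi.
(* Since V has even dimension 6, nondegeneracy of the quadratic form implies that of its polar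
   form. *)
have ndV v : (forall w, bil A v w = 0) -> v = 0.
  move=> v0; apply: (@nondeg_even_radical F A char2 3 1%:M) => //.
  - by rewrite mxrank1.
  - exact: submx1.
have r1 : \rank (perp A H0) = 1%N by rewrite (rank_perp ndV) rH.
pose m := nz_row (perp A H0).
have m0 : m != 0 by rewrite nz_row_eq0 -mxrank_eq0 r1.
have mE : (m :=: perp A H0)%MS.
  by apply/eqmxP; rewrite -(mxrank_leqif_eq (nz_row_sub _)) r1 rank_rV m0.
have mH (v : 'rV_6) : (v <= H0)%MS = (bil A v m == 0).
  rewrite -(perp_perp ndV) -perp_rowP; apply/perpP/perpP=> H w.
    by rewrite genmxE mE; apply: H.
  by move=> wX; apply: H; rewrite genmxE mE.
(* As B(m, m) = 0, [m] lies in [H0] as well as in its orthogonal; if singular, it would vanish by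
   nondegeneracy on [H0]. *)
have fm : qf A m != 0.
  by apply: contraNneq m0 => fm; apply/eqP/ndH; rewrite ?mH ?bil_alt ?mE.
have [a a0 qn] := qf_scale1 char2 fm.
have HE (v : 'rV_6) : (v <= H0)%MS = (bil A v (a *: m) == 0).
  by rewrite mH bilZr mulf_eq0 (negPf a0).
have nE : (n0 A H0 :=: a *: m)%MS.
  by apply: eqmx_trans (eqmx_sym mE) (eqmx_sym _); apply: eqmx_scale.
by split; apply: (induces_bij_phi0_aut char2 ndV wittV qn HE nE).
Qed.
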